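(* Let $a,b,c,d\in[0,1]$ with $a+c=b+d=1$. Let $C_n$ be the cycle graph with $n$ vertices ($n\ge 3$), and let ${\bf U}$ be the transition probability matrix of the second type of correlated random walk on $C_n$ with respect to $\begin{bmatrix}a&b\\c&d\end{bmatrix}$. Then $$\det(\lambda{\bf I}_{2n}-{\bf U})=\det\big((\lambda^2+(ad-bc)){\bf I}_n-\lambda{\bf W}(C_n)\big).$$
   Context: Let $V(C_n)=\{v_1,\ldots,v_n\}$ and $e_j=(v_j,v_{j+1})$ for $1\le j\le n$, subscripts modulo $n$; the arc set is $D(C_n)=\{e_1,\ldots,e_n,e_1^{-1},\ldots,e_n^{-1}\}$, where $(u,v)^{-1}=(v,u)$. For an arc $e=(u,v)$ write $o(e)=u$, $t(e)=v$. The transition probability matrix of the second type of correlated random walk on $C_n$ with respect to $\begin{bmatrix}a&b\\c&d\end{bmatrix}$ is the $2n\times 2n$ matrix ${\bf U}=(U_{ef})_{e,f\in D(C_n)}$ with: $U_{ef}=d$ if $t(f)=o(e)$, $f\ne e^{-1}$ and $f=e_j$ for some $j$; $U_{ef}=b$ if $f=e^{-1}$ and $f=e_j$ for some $j$; $U_{ef}=a$ if $t(f)=o(e)$, $f\ne e^{-1}$ and $f=e_j^{-1}$ for some $j$; $U_{ef}=c$ if $f=e^{-1}$ and $f=e_j^{-1}$ for some $j$; $U_{ef}=0$ otherwise. The $n\times n$ matrix ${\bf W}(C_n)=(w_{uv})_{u,v\in V(C_n)}$ has $w_{uv}=w(u,v)$ if $(u,v)\in D(C_n)$ and $0$ otherwise,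 where $w(e_j)=d$ and $w(e_j^{-1})=a$ for $1\le j\le n$. *)

(* Defs.v *)
From mathcomp Require Import all_boot all_order all_algebra.
Set Implicit Arguments.
Unset Strict Implicit.
Unset Printing Implicit Defensive.
Import Order.TTheory GRing.Theory Num.Theory.
Local Open Scope ring_scope.

(* The vertices v_1, ..., v_n of C_n are the elements 0, ..., n-1 of 'I_n; an
   arc (u, v) is a pair of vertices, and ordS is the successor modulo n. *)
Definition origin n (e : 'I_n * 'I_n) : 'I_n := e.1.
Definition terminus n (e : 'I_n * 'I_n) : 'I_n := e.2.
Definition arc_inv n (e : 'I_n * 'I_n) : 'I_n * 'I_n := (e.2, e.1).
Definition cycle_arc n (j : 'I_n) : 'I_n * 'I_n := (j, ordS j).

Definition is_forward n (e : 'I_n * 'I_n) : bool :=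
  [exists j : 'I_n, e == cycle_arc j].
Definition is_backward n (e : 'I_n * 'I_n) : bool :=
  [exists j : 'I_n, e == arc_inv (cycle_arc j)].

(* D(C_n) listed as e_1, ..., e_n, e_1^-1, ..., e_n^-1. *)
Definition arc n (i : 'I_(n + n)) : 'I_n * 'I_n :=
  match split i with
  | inl j => cycle_arc j
  | inr j => arc_inv (cycle_arc j)
  end.

Lemma arc_inj n : (3 <= n)%N -> injective (@arc n).
Proof.
move=> n3.
have two_steps (j k : 'I_n) : ordS j = k -> ordS k = j -> False.
  move=> <- /(congr1 val) /= /eqP.
  rewrite -addn1 modnDml addn1 -addn2 -[X in _ == X](modn_small (ltn_ord j)).
  by rewrite -[X in _ == X %[mod _]]addn0 eqn_modDl mod0n modn_small.
move=> i k; rewrite /arc => E; apply: (can_inj (@splitK n n)); move: E.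
case: (split i) => u; case: (split k) => v [].
- by move=> ->.
- by move=> uE vE; case: (two_steps v u).
- by move=> uE vE; case: (two_steps u v).
- by move=> _ ->.
Qed.

(* No arc is both forward and backward when 3 <= n, so the order of the tests
   here and in cycle_mx is immaterial. *)
Definition walk_weight (R : nzRingType) n (a b c d : R)
    (e f : 'I_n * 'I_n) : R :=
  if [&& terminus f == origin e, f != arc_inv e & is_forward f] then d
  else if (f == arc_inv e) && is_forward f then b
  else if [&& terminus f == origin e, f != arc_inv e & is_backward f] then a
  else if (f == arc_inv e) && is_backward f then c
  else 0.

Definition walk_mx (R : nzRingType) n (a b c d : R) : 'M[R]_(n + n) :=
  \matrix_(i, k) walk_weight a b c d (arc i) (arc k).

Definition cycle_mx (R : nzRingType) n (a d : R) : 'M[R]_n :=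
  \matrix_(u, v) if is_forward (u, v) then d
                 else if is_backward (u, v) then a
                 else 0.

(* Main.v *)
Require Import Defs.
From mathcomp Require Import all_boot all_order all_algebra all_fingroup.
From mathcomp Require Import ring.
Import Order.TTheory GRing.Theory Num.Theory.
Local Open Scope ring_scope.

(** A step of the walk either keeps its direction or reverses it.  List the
    forward arcs first and let [P] be the permutation matrix of the successor on
    the vertices: the transition matrix is then the block matrix with rows
    [d P^T, c I] and [b I, a P] ([walk_mx_block]), while the matrix [W] of the
    cycle is [d P + a P^T] ([cycle_mx_shift]).

    In [X I - U] the lower left block [- b I] is scalar, so it commutes with the
    lower right one, and the determinant of the [2n x 2n] matrix is that of an
    [n x n] one ([det_block_mx_comm]), namely
    [(X I - d P^T) (X I - a P) - b c I].  As [P^T P = I], this expands to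
    [(X^2 + ad - bc) I - X (d P^T + a P)].  Here [d P^T + a P] is the transpose
    of [W], and transposition does not change the determinant. *)

(** Right multiplication by the block matrix with rows [D, 0] and [- C, I]
    clears the lower left block and multiplies the determinant by [\det D],
    which can be cancelled; so [D] need not be invertible. *)
Lemma det_block_mx_comm (R : idomainType) n (A B C D : 'M[R]_n) :
  \det D != 0 -> comm_mx C D ->
  \det (block_mx A B C D) = \det (A *m D - B *m C).
Proof.
move=> D_neq0 CD; apply: (mulIf D_neq0).
have <- : \det (block_mx D 0 (- C) 1%:M) = \det D.
  by rewrite det_lblock det1 mulr1.
rewrite -det_mulmx mulmx_block !mulmx0 !mulmx1 !add0r !mulmxN CD subrr.
by rewrite det_ublock det_lblock det1 mulr1.
Qed.

Section CycleWalk.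

Variables (R : comNzRingType) (n : nat).
Hypothesis n_ge3 : (3 <= n)%N.
Implicit Types (a b c d : R) (i j : 'I_n).

Definition shift_perm : 'S_n := perm (@ordS_inj n).

Definition shift_mx : 'M[R]_n := perm_mx shift_perm.

Lemma shift_mxE i j : shift_mx i j = (ordS i == j)%:R.
Proof. by rewrite !mxE permE. Qed.

Lemma tr_shift_mxK : shift_mx^T *m shift_mx = 1%:M.
Proof. by rewrite /shift_mx tr_perm_mx -perm_mxM mulVg perm_mx1. Qed.

Lemma arc_lshift j : Defs.arc (lshift n j) = cycle_arc j.
Proof. by rewrite /Defs.arc (unsplitK (inl _ j)). Qed.

Lemma arc_rshift j : Defs.arc (rshift n j) = arc_inv (cycle_arc j).
Proof. by rewrite /Defs.arc (unsplitK (inr _ j)). Qed.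

Lemma eq_cycle_arc i j : (cycle_arc i == cycle_arc j) = (i == j).
Proof.
by rewrite -!arc_lshift (inj_eq (arc_inj n_ge3)) (inj_eq (@lshift_inj _ _)).
Qed.

Lemma eq_arc_inv i j :
  (arc_inv (cycle_arc i) == arc_inv (cycle_arc j)) = (i == j).
Proof.
by rewrite -!arc_rshift (inj_eq (arc_inj n_ge3)) (inj_eq (@rshift_inj _ _)).
Qed.

Lemma cycle_arc_neq_inv i j : (cycle_arc i == arc_inv (cycle_arc j)) = false.
Proof.
by rewrite -arc_lshift -arc_rshift (inj_eq (arc_inj n_ge3)) eq_lrshift.
Qed.

Lemma is_forward_cycle_arc j : is_forward (cycle_arc j).
Proof. by apply/existsP; exists j. Qed.

Lemma is_backward_arc_inv j : is_backward (arc_inv (cycle_arc j)).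
Proof. by apply/existsP; exists j. Qed.

Lemma is_backward_cycle_arc j : is_backward (cycle_arc j) = false.
Proof. by apply/existsP=> -[k]; rewrite cycle_arc_neq_inv. Qed.

Lemma is_forward_arc_inv j : is_forward (arc_inv (cycle_arc j)) = false.
Proof. by apply/existsP=> -[k]; rewrite eq_sym cycle_arc_neq_inv. Qed.

Lemma is_forwardE i j : is_forward (i, j) = (ordS i == j).
Proof.
apply/existsP/eqP=> [[k /eqP[-> ->]] // | <-].
by exists i.
Qed.

Lemma is_backwardE i j : is_backward (i, j) = (ordS j == i).
Proof.
apply/existsP/eqP=> [[k /eqP[-> ->]] // | <-].
by exists j.
Qed.

(** The entry at [(e, f)] is the weight of the step from [f] to [e]: the forward
    arc that continues to [e_j] is [e_(j-1)], hence the transpose in the upper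
    left block, whereas [e_j^-1] is continued from [e_(j+1)^-1].  The reversals
    pair [e_j] with [e_j^-1] and so give scalar blocks. *)
Lemma walk_mx_block a b c d :
  walk_mx n a b c d = block_mx (d *: shift_mx^T) c%:M b%:M (a *: shift_mx).
Proof.
have inv_arcK e : arc_inv (arc_inv e) = e :> 'I_n * 'I_n by case: e.
apply/matrixP=> i k; rewrite mxE -[i]splitK -[k]splitK.
case: (split i) => {}i; case: (split k) => {}k; rewrite /= ?block_mxEul
  ?block_mxEur ?block_mxEdl ?block_mxEdr ?arc_lshift ?arc_rshift /walk_weight
  ?inv_arcK ?eq_cycle_arc ?eq_arc_inv ?cycle_arc_neq_inv
  ?[arc_inv _ == cycle_arc _]eq_sym ?cycle_arc_neq_inv ?is_forward_cycle_arc
  ?is_backward_arc_inv ?is_backward_cycle_arc ?is_forward_arc_inv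
  /origin /terminus /arc_inv /= ?andbT ?andbF /=.
- by rewrite mxE [_^T _ _]mxE shift_mxE; case: eqP; rewrite ?mulr1 ?mulr0.
- by rewrite mxE eq_sym andbN; case: eqP.
- by rewrite mxE (inj_eq (@ordS_inj n)) andbN eq_sym; case: eqP.
- by rewrite mxE shift_mxE eq_sym; case: eqP; rewrite ?mulr1 ?mulr0.
Qed.

Lemma cycle_mx_shift a d : cycle_mx n a d = d *: shift_mx + a *: shift_mx^T.
Proof.
apply/matrixP=> i j; rewrite !mxE !permE is_forwardE is_backwardE.
case: (ordS i =P j) => [<- | _]; last first.
  by rewrite mulr0 add0r; case: eqP; rewrite ?mulr1 ?mulr0.
(* For [n = 2] the arc from [i] to [i + 1] would also be backward. *)
suff -> : (ordS (ordS i) == i) = false by rewrite mulr1 mulr0 addr0.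
by apply/eqP=> iE; have /eqP[] := cycle_arc_neq_inv i (ordS i);
  rewrite /arc_inv /= iE.
Qed.

End CycleWalk.

Theorem theorem7 (R : realFieldType) (n : nat) (a b c d : R)
    (n_ge3 : (3 <= n)%N)
    (a01 : 0 <= a <= 1) (b01 : 0 <= b <= 1)
    (c01 : 0 <= c <= 1) (d01 : 0 <= d <= 1)
    (ac1 : a + c = 1) (bd1 : b + d = 1) :
  \det ('X%:M - map_mx polyC (walk_mx n a b c d)) =
  \det (('X^2 + (a * d - b * c)%:P)%:M - 'X *: map_mx polyC (cycle_mx n a d))
    :> {poly R}.
Proof.
rewrite walk_mx_block // cycle_mx_shift // map_block_mx !map_scalar_mx.
rewrite -[RHS]det_tr scalar_mx_block opp_block_mx add_block_mx !add0r.
rewrite det_block_mx_comm; first last.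
- exact/comm_mx_sym/comm_mxN/comm_mx_scalar.
(* The lower right block is the characteristic matrix of [a P], so its
   determinant is monic. *)
- by rewrite -/(char_poly_mx _) monic_neq0 // char_poly_monic.
congr (\det _).
rewrite map_mxD !map_mxZ -!map_trmx.
set P := map_mx polyC (shift_mx R n).
have PK : P^T *m P = 1%:M by rewrite /P map_trmx -map_mxM tr_shift_mxK map_mx1.
have -> : (('X^2 + (a * d - b * c)%:P)%:M
             - 'X *: (d%:P *: P + a%:P *: P^T))^T =
          ('X^2 + (a * d - b * c)%:P)%:M - 'X *: (d%:P *: P^T + a%:P *: P).
  by rewrite linearB /= tr_scalar_mx linearZ linearD /= ![(_ *: _)^T]linearZ /=
             trmxK.
rewrite mulmxBl !mulmxBr -scalar_mxM mul_scalar_mx mul_mx_scalar.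
rewrite -scalemxAl -scalemxAr PK mulNmx mulmxN opprK -scalar_mxM.
(* With [P^T P] gone, the identity is linear in [P^T] and [P]. *)
move: P^T => Q; apply/matrixP=> i j; rewrite !mxE.
rewrite rmorphB !rmorphM /=; case: (i == j); rewrite ?mulr1n ?mulr0n; ring.
Qed.
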